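(* GraphDiameter2Or3 $\le_{ql}$ HyperbolicityWith2FixedVertices.
   Context: Quasilinear reductions: for an instance $I$ let $s(I)$ be its size. A quasilinear Karp reduction from problem $\mathcal P$ to problem $\mathcal Q$ (written $\mathcal P\le_{ql}\mathcal Q$) is a function $\Phi$ from instances of $\mathcal P$ to instances of $\mathcal Q$ such that for every instance $I$ of $\mathcal P$: $\Phi(I)$ can be computed in time $\tilde O(s(I))$ (that is, $O(s(I)\log^j s(I))$ for a fixed $j$), and $I$ and $\Phi(I)$ have the same output; if the output of $\mathcal Q$ is not boolean, one additionally requires a linear-time computable function transforming the output of $\Phi(I)$ into the output of $I$. GraphDiameter2Or3: input is an undirected graph $G$; output True if $G$ has diameter $2$, False otherwise. HyperbolicityWith2FixedVertices: input is an undirected graph $G=(V,E)$ and two vertices $x,y$; output is the maximum, over vertices $v,w$, of the hyperbolicity of the quadruple $(x,y,v,w)$, where the hyperbolicity of a quadruple is $S_1-S_2$, with $S_1$ the largest and $S_2$ the second largest of the three sums $d(x,y)+d(v,w)$, $d(x,v)+d(y,w)$, $d(x,w)+d(y,v)$, and $d$ the shortest-path distance. *)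

(* Defs.v *)
From mathcomp Require Import all_boot.

Set Implicit Arguments.
Unset Strict Implicit.
Unset Printing Implicit Defensive.

(** Random access machines with logarithmic cost.

    The instruction set and the cost measure are those of Cook and Reckhow
    ("Time bounded random access machines", JCSS 1973), on natural numbers with
    truncated subtraction. A program is a finite list of instructions; it halts
    when the program counter leaves the list. Registers start at 0. *)

Inductive instr :=
| Const (i c : nat)
| Add (i j k : nat)
| Sub (i j k : nat)
| LoadInd (i j : nat)
| StoreInd (i j : nat)
| JumpPos (l j : nat)
| Read (i : nat)
| Print (i : nat).

Definition program := seq instr.

Record config := Config {
  pc : nat;
  reg : nat -> nat;
  inp : seq nat;
  out : seq nat
}.

Definition upd (r : nat -> nat) (i v : nat) : nat -> nat :=
  fun k => if k == i then v else r k.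

Definition step (ins : instr) (s : config) : config :=
  let: Config l r x y := s in
  match ins with
  | Const i c => Config l.+1 (upd r i c) x y
  | Add i j k => Config l.+1 (upd r i (r j + r k)) x y
  | Sub i j k => Config l.+1 (upd r i (r j - r k)) x y
  | LoadInd i j => Config l.+1 (upd r i (r (r j))) x y
  | StoreInd i j => Config l.+1 (upd r (r i) (r j)) x y
  | JumpPos l' j => Config (if 0 < r j then l' else l.+1) r x y
  | Read i => Config l.+1 (upd r i (head 0 x)) (behead x) y
  | Print i => Config l.+1 r x (rcons y (r i))
  end.

(** Number of binary digits, with [bitlen 0 = 1]. *)
Definition bitlen (n : nat) : nat := (trunc_log 2 n).+1.

Definition cost (ins : instr) (s : config) : nat :=
  let r := reg s in
  match ins with
  | Const _ _ => 1
  | Add _ j k | Sub _ j k => bitlen (r j) + bitlen (r k)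
  | LoadInd _ j => bitlen (r j) + bitlen (r (r j))
  | StoreInd i j => bitlen (r i) + bitlen (r j)
  | JumpPos _ j => bitlen (r j)
  | Read _ => bitlen (head 0 (inp s))
  | Print i => bitlen (r i)
  end.

(** [exec p s t s']: started in [s], the program [p] halts in [s'] after a
    computation of total cost [t]. *)
Inductive exec (p : program) : config -> nat -> config -> Prop :=
| exec_halt s : onth p (pc s) = None -> exec p s 0 s
| exec_step s ins t s' :
    onth p (pc s) = Some ins -> exec p (step ins s) t s' ->
    exec p s (cost ins s + t) s'.

Definition computes (p : program) (x y : seq nat) (t : nat) : Prop :=
  exists2 s, exec p (Config 0 (fun=> 0) x [::]) t s & out s = y.

(** Functions between encoded types computable within [c * s * log^j s], where
    [s] is the size of the argument, for all large enough [s]. *)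
Definition computable_in_slog (j : nat) (A B : Type) (sizeA : A -> nat)
    (encA : A -> seq nat) (encB : B -> seq nat) (f : A -> B) : Prop :=
  exists (p : program) (c s0 : nat), forall a : A,
    exists2 t, computes p (encA a) (encB (f a)) t
      & (s0 <= sizeA a -> t <= c * (sizeA a * trunc_log 2 (sizeA a) ^ j)).

Definition quasilinear_time (A B : Type) (sizeA : A -> nat)
    (encA : A -> seq nat) (encB : B -> seq nat) (f : A -> B) : Prop :=
  exists j, computable_in_slog j sizeA encA encB f.

Definition linear_time (A B : Type) (sizeA : A -> nat)
    (encA : A -> seq nat) (encB : B -> seq nat) (f : A -> B) : Prop :=
  computable_in_slog 0 sizeA encA encB f.

Inductive output_kind := BoolOutput | NatOutput.

Definition output_type (k : output_kind) : Type :=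
  match k with BoolOutput => bool | NatOutput => nat end.

Definition output_val (k : output_kind) : output_type k -> nat :=
  match k with BoolOutput => nat_of_bool | NatOutput => id end.

Definition enc_output (k : output_kind) (o : output_type k) : seq nat :=
  [:: output_val o].

Definition size_output (k : output_kind) (o : output_type k) : nat :=
  bitlen (output_val o).

Record problem := Problem {
  instance : Type;
  isize : instance -> nat;
  enc : instance -> seq nat;
  kind : output_kind;
  answer : instance -> output_type kind
}.

(** [f] is the output on [I], [h] the output on [Phi I]: they coincide if the
    target problem is boolean, and otherwise [f] is obtained from [h] by a
    linear-time computable function. *)
Definition outputs_agree (A : Type) (k k' : output_kind) :
    (A -> output_type k) -> (A -> output_type k') -> Prop :=
  match k' as k1 return (A -> output_type k) -> (A -> output_type k1) -> Prop
  with
  | BoolOutput =>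
      match k as k0 return (A -> output_type k0) -> (A -> bool) -> Prop with
      | BoolOutput => fun f h => forall I, f I = h I
      | NatOutput => fun _ _ => False
      end
  | NatOutput => fun f h =>
      exists2 g : output_type NatOutput -> output_type k,
        linear_time (@size_output NatOutput) (@enc_output NatOutput)
          (@enc_output k) g
        & forall I, f I = g (h I)
  end.

Definition ql_reducible (P Q : problem) : Prop :=
  exists2 Phi : instance P -> instance Q,
    quasilinear_time (@isize P) (@enc P) (@enc Q) Phi
    & outputs_agree (@answer P) (fun I => answer (Phi I)).

Notation "P <=ql Q" := (ql_reducible P Q) (at level 70, no associativity).

Section Distance.
Variables (T : finType) (e : rel T).

Definition walk (u v : T) (k : nat) : bool :=
  [exists p : k.-tuple T, path e u p && (last u p == v)].

(** Shortest-path distance; it is at most [#|T|.-1] when [v] is reachable from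
    [u], and takes the dummy value [#|T|] otherwise. *)
Definition dist (u v : T) : nat := find (walk u v) (iota 0 #|T|).

Definition connected : bool := [forall u, forall v, connect e u v].

(** [None] stands for an infinite diameter. *)
Definition diameter : option nat :=
  if connected then Some (\max_u \max_v dist u v) else None.

Definition quad_hyperbolicity (x y v w : T) : nat :=
  let sums := sort geq [:: dist x y + dist v w; dist x v + dist y w;
                           dist x w + dist y v] in
  nth 0 sums 0 - nth 0 sums 1.

End Distance.

(** Finite simple undirected graph on the vertices [0, ..., nverts - 1], in
    sparse representation: every edge is listed once, smaller endpoint first. *)
Record graph := Graph {
  nverts : nat;
  edges : seq (nat * nat);
  edges_wf : uniq edges && all (fun e => e.1 < e.2 < nverts) edges
}.

Definition adj (G : graph) : rel 'I_(nverts G) :=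
  fun u v => ((val u, val v) \in edges G) || ((val v, val u) \in edges G).

Definition graph_size (G : graph) : nat := nverts G + size (edges G).

Definition enc_graph (G : graph) : seq nat :=
  [:: nverts G, size (edges G) & flatten [seq [:: e.1; e.2] | e <- edges G]].

Definition GraphDiameter2Or3 : problem :=
  @Problem graph graph_size enc_graph BoolOutput
    (fun G => diameter (@adj G) == Some 2).

(** The graph is required to be connected, so that all distances are finite. *)
Record graph2 := Graph2 {
  graph_of : graph;
  graph_connected : connected (@adj graph_of);
  vx : 'I_(nverts graph_of);
  vy : 'I_(nverts graph_of)
}.

Definition HyperbolicityWith2FixedVertices : problem :=
  @Problem graph2 (fun I => graph_size (graph_of I))
    (fun I => enc_graph (graph_of I) ++ [:: val (vx I); val (vy I)])
    NatOutput
    (fun I => \max_(v < nverts (graph_of I)) \max_(w < nverts (graph_of I))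
       quad_hyperbolicity (@adj (graph_of I)) (vx I) (vy I) v w).

(* Main.v *)
Require Import Defs.
From mathcomp Require Import all_boot.
From mathcomp Require Import zify.

(** Given [G] on [n] vertices, add two vertices [x], [y] and a path
    [x - v' - v - v'' - y] for every vertex [v] of [G]. Writing [l p = d(x, p)],
    every vertex [p] of the new graph has [d(p, y) = 4 - l p], so the
    hyperbolicity of [(x, y, p, q)] is [d(p, q) - |l p - l q|]. Detours through
    [x] and [y] bound it by [2 * min (l p) (l q)] and by
    [8 - 2 * max (l p) (l q)], hence by [2] unless [l p = l q = 2], that is,
    unless [p] and [q] are vertices of [G]; there it is
    [min (d_G(p, q)) 4]. So, if some distance in [G] is at least [2], the
    maximum is [2] exactly when [G] has diameter [2]. The remaining graphs are
    the complete ones; they are recognised by their number ['C(n, 2)] of edges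
    and sent to a one-vertex graph, whose hyperbolicity is [0]. *)

Set Implicit Arguments.
Unset Strict Implicit.
Unset Printing Implicit Defensive.

(** * Walks and distances *)

Section DistanceTheory.
Variables (T : finType) (e : rel T).
Implicit Types (u v w : T) (f : T -> nat).

Lemma walkP u v k :
  reflect (exists p, [/\ size p = k, path e u p & last u p = v]) (walk e u v k).
Proof.
apply: (iffP existsP) => [[p /andP[ep /eqP lp]]|[p [sp ep lp]]].
  by exists p; rewrite size_tuple.
by move/eqP: sp => sp; exists (Tuple sp); rewrite /= ep lp eqxx.
Qed.

Lemma walk0 u : walk e u u 0.
Proof. by apply/walkP; exists [::]. Qed.

Lemma walk1 u v : e u v -> walk e u v 1.
Proof. by move=> euv; apply/walkP; exists [:: v]; rewrite /= euv. Qed.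

Lemma walk_cat u v w j k :
  walk e u v j -> walk e v w k -> walk e u w (j + k).
Proof.
move=> /walkP[p [sp ep lp]] /walkP[q [sq eq lq]]; apply/walkP.
by exists (p ++ q); rewrite size_cat sp sq cat_path ep lp last_cat lp lq eq.
Qed.

Lemma walk_sym u v k : symmetric e -> walk e u v k -> walk e v u k.
Proof.
move=> e_sym /walkP[p [sp ep lp]]; apply/walkP; exists (rev (belast u p)).
rewrite size_rev size_belast sp -lp rev_path; split=> //.
  by rewrite (eq_path (e' := e)) // => a b; rewrite e_sym.
by case: p {sp ep lp} => //= a p; rewrite rev_cons last_rcons.
Qed.

Lemma walk_connect u v k : walk e u v k -> connect e u v.
Proof. by move=> /walkP[p [_ ep lp]]; apply/connectP; exists p. Qed.

Lemma dist_le_walk u v k : walk e u v k -> dist e u v <= k.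
Proof.
move=> Wk; rewrite /dist; have [leTk|ltkT] := leqP #|T| k.
  by rewrite (leq_trans (find_size _ _)) // size_iota.
rewrite leqNgt; apply/negP => /(before_find 0).
by rewrite nth_iota // add0n Wk.
Qed.

(** [dist] searches only lengths below [#|T|]; a connecting path with its repetitions cut out is
    that short, so the search succeeds. *)
Lemma walk_dist u v : connect e u v -> walk e u v (dist e u v).
Proof.
move=> /connectP[p ep ->]; case/shortenP: ep => q eq uq _.
set v' := last u q.
have szq : size q < #|T| by rewrite -[(size q).+1]/(size (u :: q)) -(card_uniqP uq) max_card.
have hasW : has (walk e u v') (iota 0 #|T|).
  apply/hasP; exists (size q); first by rewrite mem_iota.
  by apply/walkP; exists q.
move: (nth_find 0 hasW); rewrite nth_iota //.
by rewrite has_find size_iota in hasW.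
Qed.

Lemma dist_triangle u v w :
  connect e u v -> connect e v w -> dist e u w <= dist e u v + dist e v w.
Proof. by move=> uv vw; apply/dist_le_walk/(walk_cat (walk_dist uv))/walk_dist. Qed.

Lemma dist_le_sym u v : symmetric e -> connect e u v -> dist e v u <= dist e u v.
Proof. by move=> es uv; apply/dist_le_walk/walk_sym/walk_dist. Qed.

(** A potential that grows by at most one along each edge bounds distances from below; the gadget
    uses it with [level]. *)
Lemma lipschitz_dist f u v :
  (forall a b, e a b -> f b <= (f a).+1) -> connect e u v ->
  f v <= f u + dist e u v.
Proof.
move=> fL /walk_dist/walkP[p [<- ep <-]].
elim: p u ep => [|a p IHp] u /=; first by rewrite addn0.
by case/andP=> /fL fa /IHp IH; apply: leq_trans IH _; lia.
Qed.

Lemma dist_gt1 u v :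
  connect e u v -> u != v -> ~~ e u v -> 1 < dist e u v.
Proof.
move=> /walk_dist/walkP[[|a [|b p]] [<- /= ep <-]] //=; first by rewrite eqxx.
by move: ep; rewrite andbT => ->.
Qed.

(** Connectedness is stated separately because the dummy distance [#|T|] may itself be at most 2.
    The boolean side is local, so it can be compared between [G] and the gadget. *)
Lemma dist_le2P u v :
  reflect (connect e u v /\ dist e u v <= 2)
          [|| u == v, e u v | [exists w, e u w && e w v]].
Proof.
apply: (iffP idP) => [|[/walk_dist/walkP[p [<- ep <-]] {v}]].
  have wd k : k <= 2 -> walk e u v k -> connect e u v /\ dist e u v <= 2.
    by move=> k2 W; rewrite (leq_trans (dist_le_walk W)) ?(walk_connect W).
  case/or3P=> [/eqP->|uv|/existsP[w /andP[uw wv]]].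
  - by split; [exact: connect0 | exact: leq_trans (dist_le_walk (walk0 _)) _].
  - exact: wd (walk1 uv).
  - exact: wd (walk_cat (walk1 uw) (walk1 wv)).
case: p ep => [|a [|b [|//]]] /=; first by rewrite eqxx.
  by rewrite andbT => ->; rewrite orbT.
rewrite andbT => /andP[ua ab] _; apply/or3P/Or33/existsP.
by exists a; rewrite ua ab.
Qed.

(** The nonadjacent pair already forces a distance of at least 2, so only the upper bound remains to
    be tested. *)
Lemma diameter_eq2 :
  (exists u v, u != v /\ ~~ e u v) ->
  (diameter e == Some 2) =
  [forall u, forall v, [|| u == v, e u v | [exists w, e u w && e w v]]].
Proof.
case=> a [b [ab nab]]; rewrite /diameter; apply/idP/idP.
  case: ifP => // /forallP con /eqP[diam2].
  apply/forallP => u; apply/forallP => v; apply/dist_le2P.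
  split; first exact: (forallP (con u)).
  by rewrite -diam2 (bigmax_sup u) // (bigmax_sup v).
move=> /forallP D; have {}D u v := dist_le2P _ _ (forallP (D u) v).
have -> : connected e by apply/forallP=> u; apply/forallP=> v; case: (D u v).
apply/eqP; congr Some; apply/eqP; rewrite eqn_leq; apply/andP; split.
  apply/bigmax_leqP => u _; apply/bigmax_leqP => v _; by case: (D u v).
apply: (bigmax_sup a) => //; apply: (bigmax_sup b) => //.
by apply: dist_gt1 => //; case: (D a b).
Qed.

Lemma quad_hyperbolicityE x y v w :
  dist e x v + dist e y w <= dist e x y + dist e v w ->
  dist e x w + dist e y v <= dist e x y + dist e v w ->
  quad_hyperbolicity e x y v w =
  dist e x y + dist e v w
    - maxn (dist e x v + dist e y w) (dist e x w + dist e y v).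
Proof.
rewrite /quad_hyperbolicity.
move: (_ + _) (dist e x v + _) (dist e x w + _) => a b c ba ca.
by rewrite /sort /= /geq /=; do !case: ifP => /= ?; lia.
Qed.

End DistanceTheory.

Lemma adj_sym (G : graph) : symmetric (@adj G).
Proof. by move=> u v; rewrite /adj orbC. Qed.

Lemma edges_uniq (G : graph) : uniq (edges G).
Proof. by case/andP: (edges_wf G). Qed.

Lemma edge_bounds (G : graph) i j : (i, j) \in edges G -> i < j < nverts G.
Proof. by case/andP: (edges_wf G) => _ /allP Hall /Hall. Qed.

(** * Complete graphs *)

Definition ordered_pairs (n : nat) : seq (nat * nat) :=
  [seq (i, j) | j <- iota 0 n, i <- iota 0 j].

Lemma mem_ordered_pairs n i j : ((i, j) \in ordered_pairs n) = (i < j < n).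
Proof.
apply/allpairsPdep/idP => [[b [a []]]|/andP[ij jn]].
  by rewrite !mem_iota => bn ab [-> ->]; lia.
by exists j, i; rewrite !mem_iota.
Qed.

Lemma size_ordered_pairs n : size (ordered_pairs n) = 'C(n, 2).
Proof.
rewrite size_allpairs_dep -bin2_sum.
rewrite (eq_map (g := id)) => [|j]; last by rewrite size_iota.
by rewrite map_id sumnE /index_iota subn0.
Qed.

Lemma uniq_ordered_pairs n : uniq (ordered_pairs n).
Proof.
apply: allpairs_uniq_dep => [|j _|]; rewrite ?iota_uniq //.
by move=> [a b] [c d] _ _ /= [-> ->].
Qed.

Lemma size_edges_le (G : graph) : size (edges G) <= 'C(nverts G, 2).
Proof.
rewrite -size_ordered_pairs uniq_leq_size ?edges_uniq // => -[i j] /edge_bounds.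
by rewrite mem_ordered_pairs.
Qed.

(** The edges form a duplicate-free part of [ordered_pairs], so equal cardinality forces
    equality. *)
Lemma complete_graphP (G : graph) :
  reflect (forall u v : 'I_(nverts G), u != v -> adj u v)
          (size (edges G) == 'C(nverts G, 2)).
Proof.
have sub : {subset edges G <= ordered_pairs (nverts G)}.
  by move=> [i j] /edge_bounds; rewrite mem_ordered_pairs.
apply: (iffP eqP) => [szE u v uv|adjG].
  have [_ memE] := uniq_min_size (edges_uniq G) sub
    (eq_leq (etrans (size_ordered_pairs _) (esym szE))).
  rewrite /adj !memE !mem_ordered_pairs.
  by have := ltn_ord u; have := ltn_ord v; move: uv; rewrite -val_eqE /=; lia.
apply/eqP; rewrite eqn_leq size_edges_le -size_ordered_pairs.
apply: uniq_leq_size (uniq_ordered_pairs _) _ => -[i j].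
rewrite mem_ordered_pairs => /andP[ij jn].
have /orP[//|/edge_bounds /=] :=
  adjG (Ordinal (ltn_trans ij jn)) (Ordinal jn) (negbT (ltn_eqF ij)).
by lia.
Qed.

Definition point_graph : graph := @Graph 1 [::] isT.

Lemma point_connected : connected (@adj point_graph).
Proof.
by apply/forallP => u; apply/forallP => v; rewrite (ord1 u) (ord1 v) connect0.
Qed.

Definition point_instance : graph2 := @Graph2 point_graph point_connected ord0 ord0.

Lemma point_answer :
  @answer HyperbolicityWith2FixedVertices point_instance = 0.
Proof.
apply/eqP; rewrite -leqn0 /=; apply/bigmax_leqP => v _; apply/bigmax_leqP => w _.
by rewrite (ord1 v) (ord1 w) quad_hyperbolicityE // maxnn subnn.
Qed.

(** * The gadget graph *)

Section Gadget.
Variable G : graph.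
Let n := nverts G.

(** The vertices [n + v], [2n + v], [3n] and [3n + 1] are [v'], [v''], [x]
    and [y]. *)
Definition spoke (n v : nat) : seq (nat * nat) :=
  [:: (v, v + n); (v, v + (n + n)); (v + n, n + n + n);
      (v + (n + n), (n + n + n).+1)].

(** The order is decreasing because the program prints the spokes while counting down; [k] is kept
    apart from [n] for the induction on that loop. *)
Definition spokes (n k : nat) : seq (nat * nat) :=
  flatten [seq spoke n v | v <- rev (iota 0 k)].

Lemma mem_spokes i j :
  ((i, j) \in spokes n n) =
  [|| (i < n) && (j == i + n), (i < n) && (j == i + (n + n)),
      (n <= i < n + n) && (j == n + n + n)
    | (n + n <= i < n + n + n) && (j == (n + n + n).+1)].
Proof.
apply/flatten_mapP/idP => [[v]|].
  by rewrite mem_rev mem_iota !inE !xpair_eqE; lia.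
case/or4P=> /andP[ib /eqP->].
- by exists i; rewrite ?mem_rev ?mem_iota // !inE eqxx.
- by exists i; rewrite ?mem_rev ?mem_iota // !inE eqxx orbT.
- exists (i - n); rewrite ?mem_rev ?mem_iota ?inE ?xpair_eqE; lia.
- exists (i - (n + n)); rewrite ?mem_rev ?mem_iota ?inE ?xpair_eqE; lia.
Qed.

Lemma size_spokes k : size (spokes n k) = 4 * k.
Proof.
rewrite /spokes -[in RHS](size_iota 0 k) -(size_rev (iota 0 k)).
by elim: (rev _) => //= v s ->; lia.
Qed.

Lemma spokes_uniq : uniq (spokes n n).
Proof.
(* Numbering the four edges of a spoke turns the flattened list into [allpairs]; it remains to
   recover [(v, k)] from the edge. *)
rewrite -[spokes n n]/[seq nth (0, 0) (spoke n v) k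
                       | v <- rev (iota 0 n), k <- iota 0 4].
apply: allpairs_uniq; rewrite ?rev_uniq ?iota_uniq //.
move=> _ _ /allpairsP[[v k] [vn k4 ->]] /allpairsP[[w l] [wn l4 ->]].
move: vn k4 wn l4; rewrite !mem_rev !mem_iota /= !add0n => vn k4 wn l4 /eqP.
rewrite -[_ == _]/(_ && _).
case: k k4 => [|[|[|[|//]]]] _; case: l l4 => [|[|[|[|//]]]] _ /= /andP[/eqP E1 /eqP E2];
  congr pair; lia.
Qed.

Definition gadget_edges : seq (nat * nat) := edges G ++ spokes n n.

Lemma gadget_wf :
  uniq gadget_edges && all (fun e => e.1 < e.2 < (n + n + n).+2) gadget_edges.
Proof.
rewrite /gadget_edges cat_uniq edges_uniq spokes_uniq andbT /=; apply/andP; split.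
  apply/hasPn => -[i j]; rewrite mem_spokes => ijS.
  by apply/negP => /edge_bounds; rewrite -/n; lia.
rewrite all_cat; apply/andP; split; apply/allP => -[i j].
  by move=> /edge_bounds /=; rewrite -/n; lia.
by rewrite mem_spokes /=; lia.
Qed.

Definition gadget : graph := Graph gadget_wf.

Notation V := 'I_(nverts gadget).
Implicit Types p q : V.

Lemma gadget_adjE (i j : V) :
  adj i j = [|| (val i, val j) \in edges G, (val j, val i) \in edges G,
               (val i, val j) \in spokes n n | (val j, val i) \in spokes n n].
Proof. by rewrite /adj /= !mem_cat; do !case: (_ \in _). Qed.

(** The intended distance from [gx], read off the block of the numbering that contains [i]. *)
Definition level (i : nat) : nat :=
  if i < n then 2 else if i < n + n then 1 else if i < n + n + n then 3
  else if i == n + n + n then 0 else 4.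

Lemma spoke_adj (i j : V) :
  ((val i, val j) \in spokes n n) || ((val j, val i) \in spokes n n) -> adj i j.
Proof. by rewrite gadget_adjE => ->; rewrite !orbT. Qed.

(** Edges of [G] stay on level 2, and every spoke edge joins consecutive levels. *)
Lemma level_adj (i j : V) :
  adj i j -> (level j <= (level i).+1) && (4 - level j <= (4 - level i).+1).
Proof.
rewrite gadget_adjE !mem_spokes /level /=; move: (nat_of_ord i) (nat_of_ord j).
move=> {}i {}j /or4P[/edge_bounds|/edge_bounds||]; rewrite -/n; clearbody n;
  do !case: ifP => ?; lia.
Qed.

Lemma gx_proof : n + n + n < (n + n + n).+2. Proof. by []. Qed.
Lemma gy_proof : (n + n + n).+1 < (n + n + n).+2. Proof. by []. Qed.
Definition gx : V := Ordinal gx_proof.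
Definition gy : V := Ordinal gy_proof.

Lemma base_proof (u : 'I_n) : u < (n + n + n).+2.
Proof. by have := ltn_ord u; lia. Qed.
Lemma to_x_proof (u : 'I_n) : u + n < (n + n + n).+2.
Proof. by have := ltn_ord u; lia. Qed.
Lemma to_y_proof (u : 'I_n) : u + (n + n) < (n + n + n).+2.
Proof. by have := ltn_ord u; lia. Qed.
Definition base (u : 'I_n) : V := Ordinal (base_proof u).
Definition to_x (u : 'I_n) : V := Ordinal (to_x_proof u).
Definition to_y (u : 'I_n) : V := Ordinal (to_y_proof u).

(** Indexing by the level lets one case analysis replace a vertex and its level together. *)
Variant gadget_spec : V -> nat -> Type :=
| GadgetX : gadget_spec gx 0
| GadgetXside u : gadget_spec (to_x u) 1
| GadgetBase u : gadget_spec (base u) 2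
| GadgetYside u : gadget_spec (to_y u) 3
| GadgetY : gadget_spec gy 4.

Lemma gadgetP (p : V) : gadget_spec p (level p).
Proof.
have p_lt : p < (n + n + n).+2 := ltn_ord p.
rewrite /level; case: ifP => [pn|/negbT pn].
  have -> : p = base (Ordinal pn) by apply: val_inj.
  by constructor.
case: ifP => [pn2|/negbT pn2].
  have un : p - n < n by lia.
  have -> : p = to_x (Ordinal un) by apply: ord_inj; rewrite -[RHS]/(p - n + n); lia.
  by constructor.
case: ifP => [pn3|/negbT pn3].
  have un : p - (n + n) < n by lia.
  have -> : p = to_y (Ordinal un) by apply: ord_inj; rewrite -[RHS]/(p - (n + n) + (n + n)); lia.
  by constructor.
case: ifP => [/eqP pn4|/negbT pn4].
  have -> : p = gx by apply: val_inj.
  by constructor.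
have -> : p = gy by apply: ord_inj; rewrite -[RHS]/((n + n + n).+1); lia.
by constructor.
Qed.

Lemma adj_x_to_x u : adj gx (to_x u).
Proof. by apply: spoke_adj; rewrite !mem_spokes /=; have := ltn_ord u; lia. Qed.
Lemma adj_to_x_base u : adj (to_x u) (base u).
Proof. by apply: spoke_adj; rewrite !mem_spokes /=; have := ltn_ord u; lia. Qed.
Lemma adj_base_to_y u : adj (base u) (to_y u).
Proof. by apply: spoke_adj; rewrite !mem_spokes /=; have := ltn_ord u; lia. Qed.
Lemma adj_to_y_y u : adj (to_y u) gy.
Proof. by apply: spoke_adj; rewrite !mem_spokes /=; have := ltn_ord u; lia. Qed.

Lemma adj_base (u v : 'I_n) : adj (base u) (base v) = adj u v.
Proof.
rewrite gadget_adjE /adj !mem_spokes /=.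
have := ltn_ord u; have := ltn_ord v.
by do 2!case: (_ \in edges G) => //=; lia.
Qed.

(** The only neighbours of [base u] outside [G] are [to_x u] and [to_y u], and these touch no other
    vertex of [G]. *)
Lemma common_neighbour_base (u v : 'I_n) (p : V) :
  adj (base u) p -> adj p (base v) -> u = v \/ exists w, p = base w.
Proof.
have un := ltn_ord u; have vn := ltn_ord v.
have out i j : n <= i \/ n <= j -> ((i, j) \in edges G) = false.
  by move=> ij; apply/negP => /edge_bounds; rewrite -/n; lia.
case: (gadgetP p) => [|w|w|w|]; try (by right; exists w);
  rewrite !gadget_adjE !mem_spokes /= !out ?orFb; try lia; move=> up pv; left;
  apply: ord_inj; try have wn := ltn_ord w; lia.
Qed.

(** * Distances and hyperbolicity in the gadget *)

Hypothesis n_gt0 : 0 < n.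

Lemma walk_x p : walk (@adj gadget) gx p (level p).
Proof.
have W (u : 'I_n) := walk1 (adj_x_to_x u).
have {}W2 (u : 'I_n) := walk_cat (W u) (walk1 (adj_to_x_base u)).
have {}W3 (u : 'I_n) := walk_cat (W2 u) (walk1 (adj_base_to_y u)).
case: (gadgetP p) => // [|]; first exact: walk0.
(* [gy] belongs to no particular spoke; the walk goes through vertex 0, which exists since [n] is
   positive. *)
exact: walk_cat (W3 (Ordinal n_gt0)) (walk1 (adj_to_y_y _)).
Qed.

Lemma walk_y p : walk (@adj gadget) p gy (4 - level p).
Proof.
have W (u : 'I_n) := walk1 (adj_to_y_y u).
have {}W2 (u : 'I_n) := walk_cat (walk1 (adj_base_to_y u)) (W u).
have {}W3 (u : 'I_n) := walk_cat (walk1 (adj_to_x_base u)) (W2 u).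
case: (gadgetP p) => // [|]; last exact: walk0.
exact: walk_cat (walk1 (adj_x_to_x _)) (W3 (Ordinal n_gt0)).
Qed.

Lemma gadget_connect (p q : V) : connect (@adj gadget) p q.
Proof.
apply: (connect_trans (walk_connect (walk_sym (@adj_sym _) (walk_x p)))).
exact: walk_connect (walk_x q).
Qed.

Lemma gadget_connected : connected (@adj gadget).
Proof. by apply/forallP=> p; apply/forallP=> q; apply: gadget_connect. Qed.

Local Notation d := (dist (@adj gadget)).

Lemma gadget_dist_sym p q : d p q = d q p.
Proof.
by apply/eqP; rewrite eqn_leq !dist_le_sym // ?gadget_connect //; apply: adj_sym.
Qed.

Lemma level_dist p q : level q <= level p + d p q.
Proof.
apply: (lipschitz_dist (f := fun p : V => level p)) (gadget_connect p q) => a b.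
by case/level_adj/andP.
Qed.

Lemma dist_x p : d gx p = level p.
Proof.
apply/eqP; rewrite eqn_leq dist_le_walk ?walk_x //=.
by have := level_dist gx p; rewrite {2}/level /=; do !case: ifP => ?; lia.
Qed.

Lemma dist_y p : d gy p = 4 - level p.
Proof.
rewrite gadget_dist_sym; apply/eqP; rewrite eqn_leq dist_le_walk ?walk_y //=.
have := level_dist p gy; rewrite {1}/level /=; do !case: ifP => ?; lia.
Qed.

Lemma level_le4 (p : nat) : level p <= 4.
Proof. by rewrite /level; do !case: ifP. Qed.

(** As [d gx gy = 4], the other two sums are [4 + level p - level q] and [4 + level q - level p]; by
    [level_dist] neither exceeds [4 + d p q]. The [maxn] of truncated differences is an absolute
    value. *)
Lemma gadget_hyperbolicity p q :
  quad_hyperbolicity (@adj gadget) gx gy p q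
  = d p q - maxn (level p - level q) (level q - level p).
Proof.
have := level_dist p q; have := level_dist q p; rewrite (gadget_dist_sym q p).
have := level_le4 p; have := level_le4 q => p4 q4 dqp dpq.
have xy : d gx gy = 4.
  by rewrite dist_x /level /=; do !case: ifP => ?; lia.
by rewrite quad_hyperbolicityE; rewrite xy !dist_x !dist_y; lia.
Qed.

Lemma gadget_hyperbolicity_le2 p q :
  (forall u v, d (base u) (base v) <= 2) ->
  quad_hyperbolicity (@adj gadget) gx gy p q <= 2.
Proof.
move=> base2; rewrite gadget_hyperbolicity.
have := dist_triangle (gadget_connect p gx) (gadget_connect gx q).
have := dist_triangle (gadget_connect p gy) (gadget_connect gy q).
rewrite !(gadget_dist_sym p) !dist_x !dist_y.
(* The detours through [gx] and [gy] settle all pairs of levels except two vertices of [G]. *)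
case: (gadgetP p) => [|u|u|u|]; case: (gadgetP q) => [|v|v|v|]; try lia.
by rewrite subnn maxnn subn0 gadget_dist_sym.
Qed.

(** Only the threshold 2 matters, so the local criterion is transferred instead of computing
    distances: a two-step walk between distinct vertices of [G] has its midpoint in [G]. *)
Lemma base_dist_le2 (u v : 'I_n) :
  (d (base u) (base v) <= 2) =
  [|| u == v, adj u v | [exists w, adj u w && adj w v]].
Proof.
transitivity [|| base u == base v, adj (base u) (base v)
               | [exists w, adj (base u) w && adj w (base v)]].
  by apply/idP/dist_le2P => [|[]//]; split=> //; apply: gadget_connect.
rewrite adj_base -val_eqE /= val_eqE.
case: eqP => //= uv; case: (adj u v) => //=.
apply/existsP/existsP => -[w /andP[uw wv]]; last first.
  by exists (base w); rewrite !adj_base uw.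
have [//|[w' defw]] := common_neighbour_base uw wv.
by exists w'; rewrite -!adj_base -defw uw.
Qed.

Definition gadget_instance : graph2 := @Graph2 gadget gadget_connected gx gy.

Lemma gadget_answer :
  (exists u v : 'I_n, u != v /\ ~~ adj u v) ->
  (diameter (@adj G) == Some 2) =
  (@answer HyperbolicityWith2FixedVertices gadget_instance == 2).
Proof.
move=> nonadj; rewrite diameter_eq2 //; case: nonadj => a [b [ab nab]].
have baseE u v : quad_hyperbolicity (@adj gadget) gx gy (base u) (base v)
    = d (base u) (base v).
  rewrite gadget_hyperbolicity /level /=.
  by have := ltn_ord u; have := ltn_ord v; do !case: ifP => ?; lia.
rewrite /= eqn_leq; apply/idP/andP => [/forallP D|[/bigmax_leqP H _]].
  split.
    apply/bigmax_leqP => p _; apply/bigmax_leqP => q _.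
    apply: gadget_hyperbolicity_le2 => u v.
    by rewrite base_dist_le2; exact: (forallP (D u)).
  apply: (bigmax_sup (base a)) => //; apply: (bigmax_sup (base b)) => //.
  rewrite baseE; apply: dist_gt1; rewrite ?gadget_connect ?adj_base //.
apply/forallP => u; apply/forallP => v; rewrite -base_dist_le2 -baseE.
exact: (bigmax_leqP _ _ _ (H (base u) isT)).
Qed.

End Gadget.

(** * Correctness of the reduction *)

Lemma incomplete_nverts_gt0 (G : graph) :
  size (edges G) != 'C(nverts G, 2) -> 0 < nverts G.
Proof. by have := size_edges_le G; case: (nverts G) => //; rewrite bin0n; lia. Qed.

(** The match on [boolP] keeps the proof of incompleteness, which makes [G] nonempty and hence the
    gadget connected. *)
Definition reduction (G : graph) : graph2 :=
  match boolP (size (edges G) == 'C(nverts G, 2)) with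
  | AltTrue _ => point_instance
  | AltFalse incomplete => gadget_instance (incomplete_nverts_gt0 incomplete)
  end.

Lemma reduction_correct (G : graph) :
  (diameter (@adj G) == Some 2) =
  (@answer HyperbolicityWith2FixedVertices (reduction G) == 2).
Proof.
rewrite /reduction; case: {-}_ / boolP => [/complete_graphP adjG|incomplete].
  rewrite point_answer; apply/negP; rewrite /diameter; case: ifP => // _ /eqP[].
  (* In a complete graph all distances are at most 1. *)
  apply/eqP; rewrite neq_ltn ltnS; apply/orP; left.
  apply/bigmax_leqP => u _; apply/bigmax_leqP => v _.
  have [->|/adjG uv] := eqVneq u v; last exact: dist_le_walk (walk1 uv).
  exact: leq_trans (dist_le_walk (walk0 _ _)) _.
apply: gadget_answer.
have /existsP[u /existsP[v /andP[uv nuv]]] :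
    [exists u : 'I_(nverts G), exists v, (u != v) && ~~ adj u v].
  apply: contraR incomplete; rewrite negb_exists => /forallP nex.
  apply/complete_graphP => u v uv; have := nex u; rewrite negb_exists.
  by move/forallP/(_ v); rewrite uv negbK.
by exists u, v.
Qed.

(** * Running time *)

Lemma leq_bitlen m n : m <= n -> bitlen m <= bitlen n.
Proof. exact: leq_trunc_log. Qed.

(** An instruction costs at most two bit lengths, so a bound [B] on all numbers handled bounds the
    cost of every step. *)
Lemma bitlen_bound B m n :
  m <= B -> n <= B -> bitlen m + bitlen n <= (bitlen B).*2.
Proof. by move=> /leq_bitlen mB /leq_bitlen nB; rewrite -addnn leq_add. Qed.

Lemma bitlen_bound1 B m : m <= B -> bitlen m <= (bitlen B).*2.
Proof. by move=> /leq_bitlen mB; rewrite -addnn (leq_trans mB) ?leq_addr. Qed.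

(** Unlike [exec], this counts steps of cost at most [b] and does not require halting, so that runs
    of program fragments compose. *)
Inductive reach (p : program) (b : nat) : config -> nat -> config -> Prop :=
| reach_refl s : reach p b s 0 s
| reach_step s ins k s' :
    onth p (pc s) = Some ins -> cost ins s <= b -> reach p b (step ins s) k s' ->
    reach p b s k.+1 s'.

Lemma reach_trans p b s1 k1 s2 k2 s3 :
  reach p b s1 k1 s2 -> reach p b s2 k2 s3 -> reach p b s1 (k1 + k2) s3.
Proof.
by elim=> // s ins k s' ps cs _ IH /IH; rewrite addSn; apply: reach_step ps cs.
Qed.

Lemma reach_exec p b s k s' :
  reach p b s k s' -> onth p (pc s') = None ->
  exists2 t, exec p s t s' & t <= k * b.
Proof.
elim=> [{}s ps|{}s ins {}k {}s' ps cs _ IH /IH[t ex tb]].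
  by exists 0 => //; apply: exec_halt.
by exists (cost ins s + t); [apply: exec_step ps ex | rewrite mulSn leq_add].
Qed.

Lemma trunc_log_le_exp n k : n < 2 ^ k.+1 -> trunc_log 2 n <= k.
Proof.
by move=> nk; rewrite -ltnS -(ltn_exp2l (m := 2)) //; case: n nk => [|n] nk;
  [rewrite trunc_log0 ltn_exp2l | exact: leq_ltn_trans (trunc_logP _ _) nk].
Qed.

(** The input is 2 exactly when both truncated differences vanish; otherwise a jump reaches
    [Print 4] with register 4 still 0. *)
Definition eq2_program : program :=
  [:: Read 1; Const 2 2; Defs.Sub 3 1 2; JumpPos 7 3; Defs.Sub 3 2 1; JumpPos 7 3;
      Const 4 1; Print 4].

Ltac run_step E :=
  apply: reach_step;
  [ by []
  | rewrite /= /upd /= ?E /=;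
    first [apply: bitlen_bound | apply: bitlen_bound1 | by rewrite double_gt0];
    do ?[exact: leqnn | assumption | lia]
  | rewrite /= /upd /= ?E /= ].

Lemma eq2_linear :
  linear_time (@size_output NatOutput) (@enc_output NatOutput)
    (@enc_output BoolOutput) (fun h : nat => h == 2).
Proof.
(* At most 8 steps, each of cost at most [2 * bitlen h.+2], and [bitlen h.+2 <= bitlen h + 2 <= 4 *
   bitlen h]. *)
exists eq2_program, 64, 0 => h.
have [k [s [R k8 halt outs]]] : exists k s,
    [/\ reach eq2_program (bitlen h.+2).*2 (Config 0 (fun=> 0) [:: h] [::]) k s,
        k <= 8, onth eq2_program (pc s) = None & out s = [:: nat_of_bool (h == 2)]].
  have [lt_h|gt_h|->] := ltngtP h 2.
  - have h2 : h - 2 = 0 by lia.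
    have h2' : (0 < 2 - h) = true by lia.
    by do 2!eexists; split; first (do 7!run_step (h2, h2'); apply: reach_refl).
  - have h2 : (0 < h - 2) = true by lia.
    by do 2!eexists; split; first (do 5!run_step h2; apply: reach_refl).
  - by do 2!eexists; split; first (do 8!run_step subnn; apply: reach_refl).
have [t ex tb] := reach_exec R halt; exists t; first by exists s.
move=> _; apply: leq_trans tb _; rewrite expn0 muln1 /size_output /=.
have -> : 64 * bitlen h = 8 * (4 * bitlen h).*2 by lia.
rewrite leq_mul // leq_double.
have : bitlen h.+2 <= bitlen h + 2.
  rewrite {1}/bitlen addn2 ltnS; apply: trunc_log_le_exp; have := @trunc_log_ltn 2 h isT.
  by rewrite -/(bitlen h) !expnS; lia.
by rewrite /bitlen; lia.
Qed.

(** Register 0 keeps 0; 1, 2 and 3 hold [n], the number of edges and 1; 7 and 8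
    hold [x] and [y]. Jumps on register 3 are unconditional, 46 is the halting
    address, and the comments give the address of the next instruction. *)
Definition reduction_program : program :=
  [:: Read 1; Read 2; Const 3 1; Add 4 1 0;
      (* 4: register 5 becomes ['C(n, 2)] *)
      JumpPos 7 3; Defs.Sub 4 4 3; Add 5 5 4; JumpPos 5 4;
      Defs.Sub 6 5 2; JumpPos 15 6;
      Print 3; Print 0; Print 0; Print 0; JumpPos 46 3;
      (* 15: numbers of vertices and edges *)
      Add 6 1 1; Add 7 6 1; Add 8 7 3; Add 9 8 3; Print 9;
      Add 9 6 6; Add 9 9 2; Print 9;
      (* 23: copy the edges *)
      JumpPos 29 3; Read 9; Print 9; Read 9; Print 9; Defs.Sub 2 2 3; JumpPos 24 2;
      (* 30: print the spokes *)
      Add 4 1 0; JumpPos 43 3;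
      Defs.Sub 4 4 3; Add 9 4 1; Add 10 4 6;
      Print 4; Print 9; Print 4; Print 10; Print 9; Print 7; Print 10; Print 8;
      JumpPos 32 4;
      Print 7; Print 8].

Definition edge_list_code (E : seq (nat * nat)) : seq nat :=
  flatten [seq [:: e.1; e.2] | e <- E].

Section ReductionProgram.
Variable B : nat.
Hypothesis B_gt0 : 0 < B.
Local Notation reach := (reach reduction_program (bitlen B).*2).

(** Counting down from [k], register 5 accumulates [(k - 1) + ... + 0]. Entry is at the test, so
    [k = 0] costs just one step. *)
Lemma triangle_loop k r x y :
  r 3 = 1 -> r 4 = k -> k <= B -> r 5 + 'C(k, 2) <= B ->
  exists r', [/\ r' 5 = r 5 + 'C(k, 2), (forall i, i < 4 -> r' i = r i)
    & reach (Config 7 r x y) (3 * k).+1 (Config 8 r' x y)].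
Proof.
elim: k r => [|k IHk] r r3 r4 kB CB.
  by exists r; rewrite addn0; split=> //; run_step r4; apply: reach_refl.
have Ck : 'C(k.+1, 2) = 'C(k, 2) + k by rewrite binS bin1.
pose r1 := upd (upd r 4 k) 5 (r 5 + k).
have [||||r' [r'5 r'i R]] := IHk r1; rewrite ?/r1 /upd //=; try lia.
exists r'; split=> [|i i4|].
- by rewrite r'5 /r1 /upd /=; lia.
- by rewrite r'i //; case: i i4 => [|[|[|[|]]]].
have -> : (3 * k.+1).+1 = 3 + (3 * k).+1 by lia.
do 3!run_step (r3, r4, subn1).
exact: R.
Qed.

Lemma copy_loop (E : seq (nat * nat)) r x y :
  r 3 = 1 -> r 2 = size E -> size E <= B -> all (fun e => (e.1 <= B) && (e.2 <= B)) E ->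
  exists r', [/\ (forall i, i \in [:: 1; 3; 6; 7; 8; 0] -> r' i = r i)
    & reach (Config 29 r (edge_list_code E ++ x) y)
        (6 * size E).+1
        (Config 30 r' x (y ++ edge_list_code E))].
Proof.
elim: E r y => [|[a b] E IHE] r y /= r3 r2 EB.
  by exists r; rewrite cats0; split=> //; run_step r2; apply: reach_refl.
case/andP=> /andP[/= aB bB] allB.
pose r1 := upd (upd (upd r 9 a) 9 b) 2 (size E).
have [||||r' [r'i R]] := IHE r1 (rcons (rcons y a) b); rewrite ?/r1 /upd //=; try lia.
exists r'; split=> [i i4|].
  by rewrite r'i // /r1 /upd; do 3!(case: eqP i4 => [->|_] i4 //).
have -> : (6 * (size E).+1).+1 = 6 + (6 * size E).+1 by lia.
do 6!run_step (r3, r2, subn1).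
by move: R; rewrite !cat_rcons.
Qed.

(** Each round takes 12 steps: the test, the decrement, two additions and eight prints. The
    decrement comes first, so the spoke of [k - 1] is printed first. *)
Lemma spokes_loop n k r x y :
  r 1 = n -> r 3 = 1 -> r 4 = k -> r 6 = n + n -> r 7 = n + n + n ->
  r 8 = (n + n + n).+1 -> k <= n -> (n + n + n).+1 <= B ->
  exists r', [/\ (forall i, i \in [:: 7; 8] -> r' i = r i)
    & reach (Config 43 r x y) (12 * k).+1
        (Config 44 r' x (y ++ edge_list_code (spokes n k)))].
Proof.
elim: k r y => [|k IHk] r y r1 r3 r4 r6 r7 r8 kn nB.
  by exists r; rewrite cats0; split=> //; run_step r4; apply: reach_refl.
pose q := upd (upd (upd r 4 k) 9 (k + n)) 10 (k + (n + n)).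
have [||||||||r' [r'i R]] := IHk q (y ++ edge_list_code (spoke n k)); rewrite ?/q /upd //=; try lia.
exists r'; split=> [i i4|].
  by rewrite r'i // /q /upd; do 3!(case: eqP i4 => [->|_] i4 //).
have -> : (12 * k.+1).+1 = 12 + (12 * k).+1 by lia.
do 12!run_step (r1, r3, r4, r6, r7, r8, subn1).
have -> : spokes n k.+1 = spoke n k ++ spokes n k.
  by rewrite /spokes -addn1 iotaD rev_cat map_cat flatten_cat.
move: R; rewrite -!cats1 /edge_list_code map_cat flatten_cat -!catA /=.
exact.
Qed.

(** The triangle and spoke loops give [3 + 12] steps per vertex, the copying loop 6 per edge; 40
    covers the straight-line code. *)
Lemma reduction_reach (G : graph) :
  'C(nverts G, 2) <= B -> 4 * nverts G + size (edges G) + 2 <= B ->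
  exists k s,
    [/\ reach (Config 0 (fun=> 0) (enc_graph G) [::]) k s,
        k <= 15 * nverts G + 6 * size (edges G) + 40,
        onth reduction_program (pc s) = None
      & out s = @enc HyperbolicityWith2FixedVertices (reduction G)].
Proof.
move=> CB nB; have mC := size_edges_le G; rewrite /enc_graph.
set n := nverts G in CB nB mC *; set m := size (edges G) in nB mC *.
pose r0 := upd (upd (upd (upd (fun=> 0) 1 n) 2 m) 3 1) 4 n.
have [||||r1 [r15 r1i R1]] := @triangle_loop n r0
  (edge_list_code (edges G)) [::]; rewrite ?/r0 /upd //=; try lia.
have {}R1 : reach (Config 0 (fun=> 0) (enc_graph G) [::]) (5 + (3 * n).+1)
    (Config 8 r1 (edge_list_code (edges G)) [::]).
  by apply: reach_trans R1; do 5!run_step addn0; apply: reach_refl.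
have r15' : r1 5 = 'C(n, 2) by rewrite r15.
have {r1i} [r10 r11 r12 r13] : [/\ r1 0 = 0, r1 1 = n, r1 2 = m & r1 3 = 1].
  by rewrite !r1i.
rewrite /reduction; case: {-}_ / boolP => [complete|incomplete].
  have mE : 'C(n, 2) - m = 0 by move: complete; rewrite -/n -/m; lia.
  do 2!eexists; split.
  - apply: reach_trans R1 _.
    do 7!run_step (r10, r11, r12, r13, r15', mE); apply: reach_refl.
  - by lia.
  - by [].
  - by [].
(* Since [m] never exceeds ['C(n, 2)], the truncated difference vanishes only for complete
   graphs. *)
have mE : (0 < 'C(n, 2) - m) = true by move: incomplete; rewrite -/n -/m; lia.
have [r2 [r21 r22 r23 [r20 r26 r27 r28] R2]] : exists r2,
    [/\ r2 1 = n, r2 2 = m, r2 3 = 1,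
        [/\ r2 0 = 0, r2 6 = n + n, r2 7 = n + n + n & r2 8 = n + n + n + 1]
      & reach (Config 8 r1 (edge_list_code (edges G)) [::]) 11
          (Config 29 r2 (edge_list_code (edges G))
             [:: n + n + n + 1 + 1; n + n + (n + n) + m])].
  by eexists; split; last
    (do 11!run_step (r10, r11, r12, r13, r15', mE); exact: reach_refl).
rewrite !addn1 in r28 R2.
have [||||r3 [r3i R3]] := @copy_loop (edges G) r2 [::]
  [:: (n + n + n).+2; n + n + (n + n) + m]; rewrite //; try (rewrite -/m; lia).
  by apply/allP => -[i j] /edge_bounds /=; rewrite -/n; lia.
rewrite cats0 in R3.
have {r3i} [r30 r31 r33 [r36 r37 r38]] : [/\ r3 0 = 0, r3 1 = n, r3 3 = 1
    & [/\ r3 6 = n + n, r3 7 = n + n + n & r3 8 = (n + n + n).+1]].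
  by rewrite !r3i.
set out3 := _ ++ edge_list_code _ in R3.
have [||||||||r5 [r5i R5]] := @spokes_loop n n (upd r3 4 n) [::] out3;
  rewrite ?/upd //=; try lia.
do 2!eexists; split.
- apply: reach_trans R1 (reach_trans R2 (reach_trans R3 (reach_trans _ (reach_trans R5 _)))).
    do 2!run_step (r30, r31, r33, addn0); exact: reach_refl.
  have r57 : r5 7 = n + n + n by rewrite r5i.
  have r58 : r5 8 = (n + n + n).+1 by rewrite r5i.
  do 2!run_step (r57, r58); exact: reach_refl.
- by rewrite -/m; lia.
- by [].
rewrite /= size_cat size_spokes -/n -/m.
have -> : n + n + (n + n) + m = m + 4 * n by lia.
by rewrite /edge_list_code map_cat flatten_cat -!cats1 -!catA.
Qed.

End ReductionProgram.

(** With [l = trunc_log 2 z >= 2], [z + 4 < 2 ^ (l + 2)], so the square has at most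
    [2 * l + 4 <= 4 * l] digits. *)
Lemma bitlen_sqr_le z : 4 <= z -> bitlen ((z + 4) ^ 2) <= 4 * trunc_log 2 z.
Proof.
move=> z4; set l := trunc_log 2 z.
have l2 : 2 <= l by exact: (@leq_trunc_log 2 4 z).
have z_lt : z < 2 ^ l.+1 by apply: trunc_log_ltn.
have p_ge : 2 ^ 3 <= 2 ^ l.+1 by rewrite leq_exp2l.
apply: (@leq_trans (2 * l + 3).+1); last by lia.
rewrite ltnS; apply: trunc_log_le_exp.
have -> : (2 * l + 3).+1 = l.+2 * 2 by lia.
by rewrite expnM ltn_sqr [2 ^ l.+2]expnS; lia.
Qed.

Lemma reduction_quasilinear :
  quasilinear_time graph_size enc_graph (@enc HyperbolicityWith2FixedVertices)
    reduction.
Proof.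
(* For [z >= 4] there are at most [15 * z + 40 <= 25 * z] steps, each of cost at most
   [8 * trunc_log 2 z]. *)
exists 1, reduction_program, 200, 4 => G.
set z := graph_size G; have zE : z = nverts G + size (edges G) by [].
have CB : 'C(nverts G, 2) <= (z + 4) ^ 2.
  rewrite bin2 leq_half_double -mulnn.
  by apply: (@leq_trans ((z + 4) * (z + 4))); [apply: leq_mul; lia | lia].
have [|//||k [s [R kb halt outs]]] := @reduction_reach ((z + 4) ^ 2) _ G.
- by rewrite expn_gt0 addnS.
- by rewrite -mulnn; nia.
have [t ex tb] := reach_exec R halt; exists t; first by exists s.
move=> z4; apply: leq_trans tb _; rewrite expn1.
have -> : 200 * (z * trunc_log 2 z) = 25 * z * (4 * trunc_log 2 z).*2 by lia.
by rewrite leq_mul ?leq_double ?bitlen_sqr_le //; lia.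
Qed.

Theorem theorem8 : GraphDiameter2Or3 <=ql HyperbolicityWith2FixedVertices.
Proof.
exists reduction; first exact: reduction_quasilinear.
exists (fun h : nat => h == 2); [exact: eq2_linear | exact: reduction_correct].
Qed.
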